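(* Let $X$ be an $L$-space with convexifying operator $P$, $\omega$ an arbitrary modulus of continuity, and let $n\in\mathbb N$, $h>0$ be such that there exist vectors ${\bf t}=(t_1,\dots,t_n)$ satisfying $$a\le t_1-h<t_1+h<t_2-h<\dots<t_n+h\le b.\qquad( * )$$ For such ${\bf t}$ let $$I_{\bf t}(f)=\left(\frac1{2h}\int_{t_1-h}^{t_1+h}f(t)\,dt,\dots,\frac1{2h}\int_{t_n-h}^{t_n+h}f(t)\,dt\right).$$ Then $$\inf_{\bf t}\mathcal E(P,H^\omega([a,b],X),I_{\bf t},B([a,b],X))=\frac1{2h}\int_{(b-a)/(2n)-h}^{(b-a)/(2n)+h}\omega(u)\,du,$$ where the infimum is over all ${\bf t}$ satisfying $( * )$. The optimal information operator is $I_{{\bf t}^*}$, where ${\bf t}^*=(t_1^*,\dots,t_n^* )$, $t_k^*=a+\frac{(2k-1)(b-a)}{2n}$, and the optimal recovery method is $$\Phi^*(I_{{\bf t}^*}(f))(u)=\frac1{2h}\int_{t_k^*-h}^{t_k^*+h}f(t)\,dt,\quad u\in[\tau_k,\tau_{k+1}],\ k=1,\dots,n,$$ where $\tau_1=a$, $\tau_i=\frac12(t^*_{i-1}+t^*_i)$ for $i=2,\dots,n$, $\tau_{n+1}=b$ (at a point $\tau_i$, $2\le i\le n$, either of the two values may be taken). That is, the error $\mathcal E(P,H^\omega([a,b],X),I_{{\bf t}^*},\Phi^*,B([a,b],X))$ equals $\frac1{2h}\int_{(b-a)/(2n)-h}^{(b-a)/(2n)+h}\omega(u)\,du$.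
   Context: A modulus of continuity is a non-decreasing continuous semi-additive function $\omega\colon[0,\infty)\to[0,\infty)$ (i.e. $\omega(s+t)\le\omega(s)+\omega(t)$) with $\omega(0)=0$. A semilinear space is a set $X$ with addition and multiplication by real numbers such that for all $x,y,z\in X$, $\alpha,\beta\in\mathbb R$: $x+y=y+x$; $x+(y+z)=(x+y)+z$; there is $\theta\in X$ with $x+\theta=x$ for all $x$; $\alpha(x+y)=\alpha x+\alpha y$; $\alpha(\beta x)=(\alpha\beta)x$; $1\cdot x=x$, $0\cdot x=\theta$. An $L$-space is a semilinear space $X$ with a complete separable metric $h_X$ such that $h_X(\alpha x,\alpha y)=|\alpha|h_X(x,y)$ and $h_X(x+z,y+z)\le h_X(x,y)$. An element $x$ is convex if $(\alpha+\beta)x=\alpha x+\beta x$ for all $\alpha,\beta\ge0$; $X^{\rm c}$ is the set of convex elements. An element $x$ is invertible if there is $x'\in X$ with $x+x'=\theta$; $X^{\rm inv}$ is the set of invertible elements. Standing assumption: $X^{\rm inv}\cap X^{\rm c}\ne\{\theta\}$. $X$ is equipped with a fixed convexifying operator $P$: a surjection $P\colon X\to X^{\rm c}$ with $h_X(P(x),P(y))\le h_X(x,y)$, $P\circ P=P$, $P(\alpha x+\beta y)=\alpha P(x)+\beta P(y)$ for all $x,y\in X$, $\alpha,\beta\in\mathbb R$. It acts on functions by $(Pf)(t)=P(f(t))$. Integral: for a simple mapping $f$ taking values $f_1,\dots,f_n$ on pairwise disjoint measurable sets $T_1,\dots,T_n$, $\int f(s)\,ds:=\sum_iP(f_i)\mu(T_i)$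 ($\mu$ the Lebesgue measure); for a uniform limit $f$ of simple mappings $f^k$ (in particular for continuous $f$), $\int f:=\lim_k\int f^k$. $H^\omega([a,b],X)$ is the class of $f\colon[a,b]\to X$ with $h_X(f(t'),f(t''))\le\omega(|t'-t''|)$ for all $t',t''\in[a,b]$. $B([a,b],X)$ is the space of bounded measurable functions $f\colon[a,b]\to X$ (measurable: $t\mapsto h_X(f(t),x)$ is measurable for each $x\in X$) with metric $\sup_{t}h_X(f(t),g(t))$. Optimal recovery: given a metric space $(E,h_E)$, sets $Z,Y$, a class $W\subset Z$, and mappings $\Lambda\colon Z\to E$, $I\colon W\to Y$, a method of recovery is an arbitrary mapping $\Phi\colon Y\to E$; $\mathcal E(\Lambda,W,I,\Phi,E)=\sup_{z\in W}h_E(\Lambda(z),\Phi(I(z)))$ and $\mathcal E(\Lambda,W,I,E)=\inf_\Phi\mathcal E(\Lambda,W,I,\Phi,E)$. Here $\Phi\colon X^n\to B([a,b],X)$. *)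

(* Defs.v *)
From HB Require Import structures.
From mathcomp Require Import all_boot all_order all_algebra.
From mathcomp Require Import all_classical all_reals all_analysis.
From mathcomp Require Import measurable_realfun.

Set Implicit Arguments.
Unset Strict Implicit.
Unset Printing Implicit Defensive.

Import Order.TTheory GRing.Theory Num.Theory.
Import numFieldNormedType.Exports.

Local Open Scope classical_set_scope.
Local Open Scope ring_scope.

(* Distributivity over the sum of scalars is deliberately absent, so these are
   not the library's lSemiModType.  The addition is not taken from nmodType
   because the library has no structure joining nmodType and metricType. *)
HB.mixin Record isSemilinear (R : realType) X & Choice X := {
  sladd : X -> X -> X ;
  slzero : X ;
  slscale : R -> X -> X ;
  sladdC : commutative sladd ;
  sladdA : associative sladd ;
  sladdr0 : right_id slzero sladd ;
  slscaleDr : forall a x y,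
    slscale a (sladd x y) = sladd (slscale a x) (slscale a y) ;
  slscaleA : forall a b x, slscale a (slscale b x) = slscale (a * b) x ;
  slscale1 : forall x, slscale 1 x = x ;
  slscale0 : forall x, slscale 0 x = slzero }.

#[short(type="semilinearType")]
HB.structure Definition Semilinear (R : realType) :=
  { X of Choice X & isSemilinear R X }.

Arguments slzero {R s}.
Notation "x +! y" := (sladd x y) (at level 50, left associativity).
Notation "a *! x" := (slscale a x) (at level 40, left associativity).

Lemma sladd0r (R : realType) (X : semilinearType R) :
  left_id slzero (@sladd R X).
Proof. by move=> x; rewrite sladdC sladdr0. Qed.

HB.instance Definition _ (R : realType) (X : semilinearType R) :=
  Monoid.isComLaw.Build X slzero (@sladd R X) sladdA sladdC (@sladd0r R X).

HB.mixin Record Semilinear_isLSpace (R : realType) X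
    & Semilinear R X & Metric R X := {
  mdist_slscale : forall (a : R) (x y : X),
    mdist (a *! x) (a *! y) = `|a| * mdist x y ;
  mdist_sladd_le : forall x y z : X, mdist (x +! z) (y +! z) <= mdist x y ;
  lspace_separable : exists2 D : set X, countable D & dense D }.

#[short(type="lspaceType")]
HB.structure Definition LSpace (R : realType) :=
  { X of Semilinear R X & Metric R X & Complete X & Semilinear_isLSpace R X }.

Section LSpaces.
Variables (R : realType) (X : lspaceType R).
Implicit Types (P : X -> X) (f g : R -> X).

Definition convex_elements : set X :=
  [set x | forall a b : R, 0 <= a -> 0 <= b -> (a + b) *! x = a *! x +! b *! x].

Definition invertible_elements : set X := [set x | exists x' : X, x +! x' = slzero].

Definition convexifying_operator P : Prop :=
  [/\ range P = convex_elements,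
      forall x y, mdist (P x) (P y) <= mdist x y,
      forall x, P (P x) = P x
    & forall (a b : R) x y, P (a *! x +! b *! y) = a *! P x +! b *! P y].

(* The real line with the sigma-algebra of all Lebesgue measurable sets (the
   default measurable structure on R is the Borel one). *)
Definition lebesgue_line : measurableType _ :=
  caratheodory_type (wlength (R := R) idfun)^*%mu.

Definition lebesgue_set (A : set R) : Prop :=
  measurable (A : set lebesgue_line).

(* Functions on an interval are represented by total functions on R, of which
   only the values on the domain D matter. *)
Definition simple_on (D : set R) f : Prop :=
  finite_set (f @` D) /\
  forall x, lebesgue_set (D `&` f @^-1` [set x]).

Definition simple_integral P (D : set R) f : X :=
  \big[sladd/slzero]_(x \in f @` D)
     (fine (completed_lebesgue_measure (D `&` f @^-1` [set x])) *! P x).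

Definition is_integral P (D : set R) f (v : X) : Prop :=
  exists s : nat -> R -> X,
    [/\ forall k, simple_on D (s k),
        {uniform D, s @ \oo --> f}
      & simple_integral P D (s k) @[k --> \oo] --> v].

(* The value slzero is a dummy when f is not a uniform limit of simple mappings. *)
Definition integral P (D : set R) f : X := xget slzero (is_integral P D f).

Definition bounded_measurable (a b : R) : set (R -> X) :=
  [set f : R -> X |
    (exists (x : X) (M : R), forall t, t \in `[a, b] -> mdist (f t) x <= M) /\
    (forall x : X, measurable_fun (`[a, b]%classic : set lebesgue_line)
                     (fun t : lebesgue_line => mdist (f t) x : R))].

Definition sup_mdist (a b : R) f g : \bar R :=
  ereal_sup [set (mdist (f t) (g t))%:E | t in `[a, b]].

Definition Homega (a b : R) (w : R -> R) : set (R -> X) :=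
  [set f | forall s t, s \in `[a, b] -> t \in `[a, b] ->
             mdist (f s) (f t) <= w `|s - t|].

Definition averages P (n : nat) (h : R) (t : 'I_n -> R) f : 'I_n -> X :=
  fun k => (2 * h)^-1 *! integral P `[t k - h, t k + h] f.

End LSpaces.

Arguments convex_elements {R} X.
Arguments invertible_elements {R} X.
Arguments bounded_measurable {R} X.
Arguments Homega {R} X.

Definition modulus_of_continuity (R : realType) (w : R -> R) : Prop :=
  [/\ forall s, 0 <= s -> 0 <= w s,
      forall s t, 0 <= s -> s <= t -> w s <= w t,
      {within `[0, +oo[, continuous w},
      forall s t, 0 <= s -> 0 <= t -> w (s + t) <= w s + w t
    & w 0 = 0].

Section OptimalRecovery.
Variables (R : realType) (Z Y E : Type).

Definition recovery_error (hE : E -> E -> \bar R) (Lambda : Z -> E)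
    (W : set Z) (I : Z -> Y) (Phi : Y -> E) : \bar R :=
  ereal_sup [set hE (Lambda z) (Phi (I z)) | z in W].

(* The metric space is given as a subset B of the carrier type E; the methods
   of recovery are all the mappings from Y to B. *)
Definition optimal_error (hE : E -> E -> \bar R) (B : set E) (Lambda : Z -> E)
    (W : set Z) (I : Z -> Y) : \bar R :=
  ereal_inf [set recovery_error hE Lambda W I Phi
            | Phi in [set Phi : Y -> E | forall y, B (Phi y)]].

End OptimalRecovery.

Section Nodes.
Variables (R : realType) (a b h : R) (n : nat).

Definition admissible_nodes : set ('I_n -> R) :=
  [set t | [/\ forall i : 'I_n, i = 0%N :> nat -> a <= t i - h,
               forall i : 'I_n, t i - h < t i + h,
               forall i j : 'I_n, j = i.+1 :> nat -> t i + h < t j - h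
             & forall i : 'I_n, i.+1 = n -> t i + h <= b]].

(* Indices start at 0: optimal_node k is t*_(k+1) and cell_end k is
   tau_(k+1). *)
Definition optimal_node (k : nat) : R :=
  a + (2 * k.+1%:R - 1) * (b - a) / (2 * n%:R).

Definition optimal_nodes : 'I_n -> R := fun k => optimal_node k.

Definition cell_end (k : nat) : R :=
  if k == 0%N then a else if k == n then b
  else (optimal_node k.-1 + optimal_node k) / 2.

End Nodes.

Arguments admissible_nodes {R} a b h n.
Arguments optimal_nodes {R} a b n.

Section Recovery.
Variables (R : realType) (X : lspaceType R) (P : X -> X) (w : R -> R).
Variables (a b h : R) (n : nat).

Lemma convexifying_bounded_measurable f :
  modulus_of_continuity w -> convexifying_operator P ->
  Homega X a b w f -> bounded_measurable X a b (P \o f).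
Proof.
move=> [w0 wle wcont _ w00] [_ Ple _ _] Hf; split.
  exists (P (f a)), (w (b - a)) => t tab.
  have /andP[at_ tb] : a <= t <= b by move: tab; rewrite in_itv.
  apply: (le_trans (Ple _ _)); apply: (le_trans (Hf _ _ tab _)).
    by rewrite in_itv /= lexx (le_trans at_ tb).
  by rewrite ger0_norm ?subr_ge0// wle ?subr_ge0// lerB.
move=> x.
have dist_lip (y z : X) : `|mdist y x - mdist z x| <= mdist y z.
  rewrite ler_norml lerBlDr lerBrDr metric_triangle andbT.
  by rewrite addrC lerBlDr addrC (metric_sym y z) metric_triangle.
have cg : {within `[a, b], continuous (fun t => mdist (P (f t)) x : R)}.
  apply/subspace_continuousP => s sab; apply/cvgrPdist_lt => e e0.
  move/subspace_continuousP : wcont => /(_ 0).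
  rewrite /= in_itv /= lexx => /(_ isT) /cvgrPdist_lt /(_ e e0).
  rewrite near_withinE /from_subspace w00 => /nbhs_ballP[d d0 wd].
  rewrite near_withinE; apply/nbhs_ballP; exists d => //= t st tab.
  apply: (le_lt_trans (dist_lip _ _)); apply: (le_lt_trans (Ple _ _)).
  apply: (le_lt_trans (Hf _ _ sab tab)).
  have := wd `|s - t|; rewrite /ball/= !sub0r !normrN normr_id in_itv/= normr_ge0.
  by rewrite (ger0_norm (w0 _ _))//; exact.
have mg : measurable_fun `[a, b] (fun t => mdist (P (f t)) x : R).
  exact: subspace_continuous_measurable_fun.
move=> _ Y mY; apply: sub_caratheodory.
exact: (mg (measurable_itv _) Y mY).
Qed.

Definition mean_recovery_error (t : 'I_n -> R)
    (Phi : ('I_n -> X) -> R -> X) : \bar R :=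
  recovery_error (sup_mdist a b) (fun f => P \o f) (Homega X a b w)
    (averages P h t) Phi.

Definition mean_optimal_error (t : 'I_n -> R) : \bar R :=
  optimal_error (sup_mdist a b) (bounded_measurable X a b)
    (fun f => P \o f) (Homega X a b w) (averages P h t).

(* At a common end point of two cells either of the two values is allowed. *)
Definition piecewise_constant_method (Phi : ('I_n -> X) -> R -> X) : Prop :=
  (forall y, bounded_measurable X a b (Phi y)) /\
  forall f, Homega X a b w f -> forall u, u \in `[a, b] ->
    exists2 k : 'I_n, u \in `[cell_end a b n k, cell_end a b n k.+1] &
      Phi (averages P h (optimal_nodes a b n) f) u =
        averages P h (optimal_nodes a b n) f k.

Definition optimal_value : R :=
  (2 * h)^-1 * \int[lebesgue_measure]_(u in
     `[(b - a) / (2 * n%:R) - h, (b - a) / (2 * n%:R) + h]) w u.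

End Recovery.

(* Main.v *)
(** The Riemann sums of [P \o f] converge to the integral of [f], because
    integrals of simple mappings over a common refinement are compared term by
    term; this reduces estimates on integrals in [X] to real Riemann sums.

    Let [r = (b - a) / 2n]. For the upper bound, [P (f u)] differs from the mean
    of [f] around a node [t] by at most the mean of [w `|s - u|] over
    [t - h <= s <= t + h], and sliding this window away from [u] increases the
    mean, so the worst case is [`|u - t| = r].

    For the lower bound, pigeonhole gives a point [u] at distance at least [r]
    from all nodes. Folding the line by a 1-Lipschitz map [kap] that sends [u]
    to [0] and each window isometrically onto [[r - h, r + h]], the function
    [psi = V - w \o kap], with [V] the optimal value, has modulus [w], zero mean
    on every window and [psi u = V]. An invertible convex element spans an
    isometric copy of the real line in [X]; the images of [psi] and [- psi] have
    the same averages, and their values at [u] are at distance [2 * V]. *)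

Require Import Defs.
From mathcomp Require Import all_boot all_order all_algebra.
From mathcomp Require Import normed_module.
Import numFieldNormedType.Exports.
From mathcomp Require Import all_classical all_reals all_analysis.
From mathcomp Require Import finmap measurable_realfun lra zify.

Set Implicit Arguments.
Unset Strict Implicit.
Unset Printing Implicit Defensive.

Import Order.TTheory GRing.Theory Num.Theory.
Import numFieldNormedType.Exports.

Local Open Scope classical_set_scope.
Local Open Scope ring_scope.

(** * Metric and algebra of L-spaces; the line spanned by an invertible element *)

Section LSpaceTheory.
Variables (R : realType) (X : lspaceType R).
Implicit Types (x y z : X) (a b r s : R).

Lemma slscaler0 a : a *! (slzero : X) = slzero.
Proof. by rewrite -[X in a *! X](slscale0 slzero) slscaleA mulr0 slscale0. Qed.

Lemma le_mdistD x y x' y' :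
  mdist (x +! y) (x' +! y') <= mdist x x' + mdist y y'.
Proof.
apply: (le_trans (metric_triangle _ (x' +! y) _)); rewrite lerD ?mdist_sladd_le//.
by rewrite !(sladdC x') mdist_sladd_le.
Qed.

Lemma le_mdist_sum (I : Type) (l : seq I) (F G : I -> X) :
  mdist (\big[sladd/slzero]_(i <- l) F i) (\big[sladd/slzero]_(i <- l) G i)
  <= \sum_(i <- l) mdist (F i) (G i).
Proof.
elim/big_ind3: _ => [|x x' r y y' s Hx Hy|//]; first by rewrite mdistxx.
by rewrite (le_trans (le_mdistD _ _ _ _))// lerD.
Qed.

Lemma slscale_sumr (I : Type) (l : seq I) (r : I -> R) x :
  convex_elements X x -> (forall i, 0 <= r i) ->
  (\sum_(i <- l) r i) *! x = \big[sladd/slzero]_(i <- l) (r i *! x).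
Proof.
move=> cx r0; elim: l => [|i l IH]; first by rewrite !big_nil slscale0.
by rewrite !big_cons cx ?IH// sumr_ge0.
Qed.

(** Translations do not increase distances, and translating back by [z'] gives the reverse
    inequality. *)
Lemma mdist_sladd_inv x y z z' : z +! z' = slzero ->
  mdist (x +! z) (y +! z) = mdist x y.
Proof.
move=> zz'; apply/eqP; rewrite eq_le mdist_sladd_le /=.
have := mdist_sladd_le (x +! z) (y +! z) z'.
by rewrite -!sladdA zz' !sladdr0.
Qed.

Section Convexifying.
Variable P : X -> X.
Hypothesis HP : convexifying_operator P.

Lemma convexifying_convex x : convex_elements X (P x).
Proof. by case: HP => <- _ _ _; exists x. Qed.

Lemma convexifying_fix x : convex_elements X x -> P x = x.
Proof. by case: HP => <- _ PP _ [y _ <-]. Qed.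

Lemma convexifyingD x y : P (x +! y) = P x +! P y.
Proof. by case: HP => _ _ _ /(_ 1 1 x y); rewrite !slscale1. Qed.

Lemma convexifyingZ a x : P (a *! x) = a *! P x.
Proof.
by case: HP => _ _ _ /(_ a 0 x x); rewrite !slscale0 !sladdr0.
Qed.

Lemma convexifying0 : P slzero = slzero.
Proof. by rewrite -(slscale0 slzero) convexifyingZ !slscale0. Qed.

(** Since [P x = x], one has [P x' = x' +! (x +! P x') = x' +! P (x +! x') = x'], and values of [P]
    are convex. *)
Lemma convexifying_inv x x' : convex_elements X x -> x +! x' = slzero ->
  convex_elements X x'.
Proof.
move=> cx xx'; suff <- : P x' = x' by exact: convexifying_convex.
rewrite -[LHS]sladd0r -xx' (sladdC x) -sladdA -[X in _ +! (X +! _)]convexifying_fix//.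
by rewrite -convexifyingD xx' convexifying0 sladdr0.
Qed.

End Convexifying.

Section Line.
Variables (x x' : X).
Hypotheses (cx : convex_elements X x) (cx' : convex_elements X x').
Hypothesis xx' : x +! x' = slzero.

(* [x'] need not be [(-1) *! x]: multiplication by a negative scalar is
   unrelated to the addition, e.g. [a *! x := `|a| * x] on the reals. *)
Definition line r : X := Num.max r 0 *! x +! Num.max (- r) 0 *! x'.

Lemma line0 : line 0 = slzero.
Proof. by rewrite /line oppr0 maxxx !slscale0 sladdr0. Qed.

Lemma line_ge0 r : 0 <= r -> line r = r *! x.
Proof.
by move=> r0; rewrite /line max_l// max_r ?oppr_le0// slscale0 sladdr0.
Qed.

(** Convexity splits off the smaller of [r] and [s], and this common part cancels because
    [c *! x +! c *! x'] is zero. Hence any difference of nonnegative reals may replace the positive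
    and negative parts, which is what additivity of [line] needs. *)
Lemma line_subE r s : 0 <= r -> 0 <= s -> line (r - s) = r *! x +! s *! x'.
Proof.
have inv c : c *! x +! c *! x' = slzero by rewrite -slscaleDr xx' slscaler0.
move=> r0 s0; rewrite /line; have [sr|rs] := leP s r.
  rewrite max_l ?subr_ge0// max_r ?oppr_le0 ?subr_ge0// slscale0 sladdr0.
  have := @cx (r - s) s; rewrite subr_ge0 subrK => ->//.
  by rewrite -sladdA inv sladdr0.
rewrite max_r ?subr_le0 1?ltW// slscale0 sladd0r opprB max_l ?subr_ge0 1?ltW//.
have := @cx' (s - r) r; rewrite subr_ge0 subrK => ->//; last exact: ltW.
by rewrite (sladdC ((s - r) *! x')) sladdA inv sladd0r.
Qed.

Lemma lineD r s : line (r + s) = line r +! line s.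
Proof.
have E (t : R) : t = Num.max t 0 - Num.max (- t) 0.
  by have [|] := leP t 0 => t0; [rewrite max_l ?oppr_ge0//; lra|rewrite max_r; lra].
have -> : r + s = (Num.max r 0 + Num.max s 0) - (Num.max (- r) 0 + Num.max (- s) 0).
  by rewrite {1}(E r) {1}(E s); lra.
have m0 (t : R) : 0 <= Num.max t 0 by rewrite le_max lexx orbT.
by rewrite line_subE ?addr_ge0// cx// cx'// /line Monoid.mulmACA.
Qed.

Lemma lineZ a r : 0 <= a -> line (a * r) = a *! line r.
Proof.
move=> a0; rewrite /line slscaleDr !slscaleA !maxr_pMr// mulr0 //.
by rewrite mulrN.
Qed.

(** Points of the line are invertible, so translation by them is an isometry and only distances from
    zero matter; these follow from homogeneity of the metric. *)
Lemma mdist_line r s : mdist (line r) (line s) = `|r - s| * mdist x slzero.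
Proof.
have d0 t : mdist (line t) slzero = `|t| * mdist x slzero.
  wlog t0 : t / 0 <= t => [W|].
    have [t0|/ltW t0] := leP 0 t; first exact: W.
    have tNt : line (- t) +! line t = slzero by rewrite -lineD addNr line0.
    (* Translation by [line (- t)] takes zero and [line t] to [line (- t)] and zero. *)
    rewrite -normrN -W ?oppr_ge0// (metric_sym (line t)) -(mdist_sladd_inv slzero (line t) tNt).
    by rewrite sladd0r -lineD subrr line0.
  by rewrite line_ge0// -[X in mdist _ X](slscaler0 t) mdist_slscale.
have sNs : line s +! line (- s) = slzero by rewrite -lineD subrr line0.
rewrite -d0 -(mdist_sladd_inv (line (r - s)) slzero sNs).
by rewrite -lineD subrK sladd0r.
Qed.

Lemma line_sum (I : Type) (l : seq I) (r : I -> R) :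
  \big[sladd/slzero]_(i <- l) line (r i) = line (\sum_(i <- l) r i).
Proof. by elim/big_ind2: _ => [|y r1 z r2 -> ->|//]; rewrite ?line0 ?lineD. Qed.

Lemma line_convex r : convex_elements X (line r).
Proof. by move=> a b a0 b0; rewrite -!lineZ ?addr_ge0// -lineD mulrDl. Qed.

End Line.

End LSpaceTheory.

(** * Lebesgue measure of intervals and of finite partitions *)

Section LebesgueMeasure.
Variable R : realType.

Definition leb (A : set R) : R := fine (completed_lebesgue_measure A).

Lemma completed_lebesgue_measure_itv (c d : R) (bc bd : bool) : c <= d ->
  completed_lebesgue_measure [set` Interval (BSide bc c) (BSide bd d)]
  = (d - c)%:E.
Proof.
move=> cd.
(* As set functions the two measures are convertible, so the formula for intervals carries over. *)
transitivity (lebesgue_measure [set` Interval (BSide bc c) (BSide bd d)] : \bar R).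
  by [].
rewrite lebesgue_measure_itv /= lte_fin.
by case: ltP => // dc; rewrite (@le_anti _ _ c d) ?cd// subrr.
Qed.

Lemma lebesgue_set_itv (i : interval R) : lebesgue_set [set` i].
Proof. by apply: sub_caratheodory; exact: measurable_itv. Qed.

Lemma leb_ge0 (A : set R) : 0 <= leb A.
Proof. exact/fine_ge0/measure_ge0. Qed.

(** The map [e] labels the pieces of [A], and [A] is their finite disjoint union. Finiteness of the
    measure lets [fine] commute with the sum. *)
Lemma leb_partition (I : choiceType) (E : {fset I}) (e : R -> I) (A : set R) :
  (completed_lebesgue_measure A < +oo)%E ->
  (forall i, lebesgue_set (A `&` e @^-1` [set i])) ->
  (forall t, A t -> e t \in E) ->
  lebesgue_set A /\ leb A = \sum_(i <- E) leb (A `&` e @^-1` [set i]).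
Proof.
move=> Afin mAe AE.
have AU : A = \big[setU/set0]_(i <- E) (A `&` e @^-1` [set i]).
  rewrite -bigcup_fset; apply/seteqP; split => [t At|t [i _ []//]].
  by exists (e t) => //=; exact: AE.
have mA : lebesgue_set A.
  by rewrite AU; apply: bigsetU_measurable => i _; exact: mAe.
have fin i : completed_lebesgue_measure (A `&` e @^-1` [set i]) \is a fin_num.
  rewrite ge0_fin_numE ?measure_ge0//; apply: le_lt_trans Afin.
  by apply: le_outer_measure; exact: subIsetl.
split=> //; rewrite /leb {1}AU measure_fbigsetU; last 2 first.
  by move=> i _; exact: mAe.
  apply/trivIsetP => i j _ _ ij; rewrite -subset0 => t [[_ /= ei] [_ /= ej]].
  by move: ij; rewrite -ei -ej eqxx.
by rewrite sum_fine.
Qed.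

End LebesgueMeasure.

(** * Integrals of simple mappings *)

Section SimpleIntegral.
Variables (R : realType) (X : lspaceType R) (P : X -> X).
Hypothesis HP : convexifying_operator P.
Variables (D : set R) (Dfin : (completed_lebesgue_measure D < +oo)%E).

(* A simple mapping may be integrated over any finite partition of [D] on
   whose pieces it is constant, not only over the partition into its fibers. *)
Lemma simple_refine (I : choiceType) (E : {fset I}) (e : R -> I)
    (phi : I -> X) (s : R -> X) :
  (forall i, lebesgue_set (D `&` e @^-1` [set i])) ->
  (forall t, D t -> e t \in E) ->
  (forall t, D t -> s t = phi (e t)) ->
  simple_on D s /\ simple_integral P D s =
    \big[sladd/slzero]_(i <- E) (leb (D `&` e @^-1` [set i]) *! P (phi i)).
Proof.
move=> mDe DE sphi.
have sD : s @` D `<=` [set` [fset phi i | i in E]%fset].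
  by move=> _ [t Dt <-]; rewrite /= sphi//; apply/imfsetP; exists (e t); rewrite ?DE.
have [mD _] := leb_partition Dfin mDe DE.
(* On a piece [s] is constant, so each fiber of [s] contains the piece or misses it. *)
have fiberI x i : D `&` s @^-1` [set x] `&` e @^-1` [set i]
    = if phi i == x then D `&` e @^-1` [set i] else set0.
  case: eqP => [<-|ix]; apply/seteqP; split => t //=.
  - by move=> [[Dt _] ?].
  - by move=> [Dt et]; rewrite sphi ?et.
  - by move=> [[Dt]]; rewrite sphi// => /[swap] ->.
have mfiberI x i : lebesgue_set (D `&` s @^-1` [set x] `&` e @^-1` [set i]).
  by rewrite fiberI; case: eqP => // _; exact: measurable0.
have fiberE x t : (D `&` s @^-1` [set x]) t -> e t \in E by case=> /DE.
have fiber_fin x : (completed_lebesgue_measure (D `&` s @^-1` [set x]) < +oo)%E.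
  by apply: le_lt_trans Dfin; apply: le_outer_measure; exact: subIsetl.
have mfiber x := leb_partition (fiber_fin x) (mfiberI x) (@fiberE x).
have simple_s : simple_on D s.
  split=> [|x]; last by have [] := mfiber x.
  exact: sub_finite_set sD _.
split=> //; rewrite (partition_big_imfset _ phi) /=.
(* Labels in [E] may have empty pieces, so [phi] may take values that [s] does not attain on [D];
   their fibers are empty and enter with weight zero. *)
rewrite /simple_integral (fsbig_fwiden [fset phi i | i in E]%fset)//=; last first.
  move=> x [_ /= xs]; apply/eqP.
  rewrite [X in fine (_ X)](_ : _ = set0) ?measure0 ?slscale0//.
  by rewrite -subset0 => t [Dt] /= stx; apply: xs; exists t.
apply: eq_bigr => x _; have [_] := mfiber x; rewrite /leb => ->.
(* Splitting the measure of a fiber into those of its pieces is legitimate because [P x] is convex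
   and measures are nonnegative. *)
rewrite slscale_sumr; last 2 first.
  exact: convexifying_convex.
  by move=> i; exact: leb_ge0.
rewrite [RHS]big_mkcond/=; apply: eq_bigr => i _; rewrite fiberI.
by case: eqP => [->|]//; rewrite /leb measure0 slscale0.
Qed.

Lemma le_mdist_simple_integral (s1 s2 : R -> X) (eps : R) :
  simple_on D s1 -> simple_on D s2 ->
  (forall t, D t -> mdist (s1 t) (s2 t) <= eps) ->
  mdist (simple_integral P D s1) (simple_integral P D s2) <= eps * leb D.
Proof.
move=> [fin1 m1] [fin2 m2] s12.
(* Labelling points by the pair of values gives a common refinement of both partitions. *)
pose e t := (s1 t, s2 t).
pose E := fset_set (s1 @` D `*` s2 @` D).
have finE : finite_set (s1 @` D `*` s2 @` D) by exact: finite_setX.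
have me i : lebesgue_set (D `&` e @^-1` [set i]).
  rewrite [X in lebesgue_set X](_ : _ = (D `&` s1 @^-1` [set i.1]) `&` (D `&` s2 @^-1` [set i.2])).
    by apply: measurableI; [exact: m1|exact: m2].
  apply/seteqP; split => t /=; first by move=> [Dt <-].
  by move=> [[Dt e1] [_ e2]]; split => //; rewrite /e e1 e2; case: (i).
have eE t : D t -> e t \in E.
  by move=> Dt; rewrite in_fset_set//; apply: mem_set; split; exists t.
have [_ ->] := simple_refine me eE (phi := fst) (s := s1) (fun _ _ => erefl).
have [_ ->] := simple_refine me eE (phi := snd) (s := s2) (fun _ _ => erefl).
apply: (le_trans (le_mdist_sum _ _ _)).
have [_ ->] := leb_partition Dfin me eE.
rewrite mulr_sumr; apply: ler_sum => i _.
rewrite mdist_slscale ger0_norm ?leb_ge0// mulrC.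
(* The hypothesis bounds only pairs of values that are attained together; the other pairs have an
   empty piece. *)
have [->|/set0P[t [Dt <-]]] := eqVneq (D `&` e @^-1` [set i]) set0.
  by rewrite /leb measure0 !mulr0.
rewrite ler_wpM2r ?leb_ge0//=; case: HP => _ Ple _ _.
exact: le_trans (Ple _ _) (s12 _ Dt).
Qed.

End SimpleIntegral.

(** * Moduli of continuity *)

Section Moduli.
Variables (R : realType) (w : R -> R).
Hypothesis Hw : modulus_of_continuity w.

Lemma modulus_le s t : 0 <= s -> s <= t -> w s <= w t.
Proof. by case: Hw => _ + _ _ _; apply. Qed.

Lemma modulus_small (eps : R) : 0 < eps ->
  exists2 eta, 0 < eta & forall s, 0 <= s -> s < eta -> w s < eps.
Proof.
case: Hw => w0 _ cw _ w00 e0.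
move/subspace_continuousP : cw => /(_ 0).
rewrite /= in_itv /= lexx => /(_ isT) /cvgrPdist_lt /(_ eps e0).
rewrite near_withinE /from_subspace w00 => /nbhs_ballP[d d0 wd].
exists d => // s s0 sd; have := wd s.
rewrite /ball /= !sub0r !normrN !ger0_norm ?w0// in_itv/= s0.
by apply.
Qed.

Lemma modulus_mesh_small (l eps : R) : 0 <= l -> 0 < eps ->
  \forall m \near \oo, w (l / m.+1%:R) < eps.
Proof.
move=> l0 /modulus_small[eta eta0 weta].
(* From this index on, [l / eta < m.+1], that is, the mesh is below [eta]. *)
exists (Num.truncn (l / eta)) => // m /= Hm; apply: weta; first by rewrite divr_ge0.
rewrite ltr_pdivrMr// mulrC -ltr_pdivrMr//.
by rewrite (lt_le_trans (truncnS_gt _))// ler_nat ltnS.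
Qed.

(** Semi-additivity is applied to the decomposition of the larger absolute value as the smaller one
    plus the difference. *)
Lemma modulus_norm_lipschitz (s t : R) : `|w `|s| - w `|t| | <= w `|s - t|.
Proof.
wlog st : s t / `|t| <= `|s| => [W|].
  by have [/W//|/ltW/W] := leP `|t| `|s|; rewrite distrC (distrC s).
rewrite ger0_norm ?subr_ge0 ?modulus_le// lerBlDr.
have -> : `|s| = (`|s| - `|t|) + `|t| by rewrite subrK.
case: Hw => _ _ _ wD _; rewrite (le_trans (wD _ _ _ _)) ?subr_ge0//.
by rewrite lerD2r modulus_le ?subr_ge0// lerB_dist.
Qed.

End Moduli.

(** * The integral in an L-space and its Riemann sums *)

Section Integral.
Variables (R : realType) (X : lspaceType R) (P : X -> X).
Hypothesis HP : convexifying_operator P.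

Lemma uniform_mdistP (D : set R) (s : nat -> R -> X) f :
  {uniform D, s @ \oo --> f} <->
  forall eps : R, 0 < eps -> \forall k \near \oo, forall t, D t -> mdist (f t) (s k t) < eps.
Proof.
split=> [sf eps e0|sf].
  apply: (sf [set g : R -> X | forall t, D t -> mdist (f t) (g t) < eps]).
  apply/uniform_nbhs; exists [set xy | ball xy.1 eps xy.2]; split.
    exact: (entourage_ball _ (PosNum e0)).
  by move=> g Hg t Dt; have := Hg t Dt; rewrite /= ballEmdist.
move=> A /uniform_nbhs[E [entE EA]].
move: entE; rewrite -entourage_ballE => -[eps e0 epsE].
have := sf _ e0; apply: filterS => k Hk; apply: EA => t Dt /=.
by apply: epsE; rewrite /= ballEmdist; exact: Hk.
Qed.

(** Two approximating sequences are eventually uniformly close to each other, hence so are their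
    integrals. Thus the value chosen by [xget] can be computed from any approximating sequence. *)
Lemma is_integral_unique (D : set R) f v v' :
  (completed_lebesgue_measure D < +oo)%E ->
  is_integral P D f v -> is_integral P D f v' -> v = v'.
Proof.
move=> Dfin [s [ss /uniform_mdistP sf sv]] [s' [ss' /uniform_mdistP sf' sv']].
apply: mdist_positivity; apply/eqP; rewrite eq_le mdist_ge0 andbT.
apply/ler_addgt0Pr => /= eps e0; rewrite add0r.
have l0 := leb_ge0 D.
(* The errors are [del] at each of the two limits and [2 * del * leb D] between the simple
   integrals, [eps] in total. *)
pose del := eps / (2 + 2 * leb D).
have d0 : 0 < del by rewrite divr_gt0//; lra.
move/metricType_numDomainType.cvgrPdist_lt : sv => /(_ _ d0) sv.
move/metricType_numDomainType.cvgrPdist_lt : sv' => /(_ _ d0) sv'.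
near \oo => k.
have Hv : mdist v (simple_integral P D (s k)) < del by near: k.
have Hv' : mdist v' (simple_integral P D (s' k)) < del by near: k.
have Hs : forall t, D t -> mdist (f t) (s k t) < del by near: k; exact: sf.
have Hs' : forall t, D t -> mdist (f t) (s' k t) < del by near: k; exact: sf'.
have Hss : mdist (simple_integral P D (s k)) (simple_integral P D (s' k))
    <= (2 * del) * leb D.
  apply: (le_mdist_simple_integral HP) => // t Dt.
  rewrite (le_trans (metric_triangle _ (f t) _))// metric_sym mulr_natl mulr2n.
  by rewrite lerD// ltW// ?Hs ?Hs'.
apply: (le_trans (metric_triangle _ (simple_integral P D (s k)) _)).
apply: (le_trans (lerD (ltW Hv) (metric_triangle _ (simple_integral P D (s' k)) _))).
rewrite (metric_sym _ v') (le_trans (lerD (lexx _) (lerD Hss (ltW Hv'))))//.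
have <- : del * (2 + 2 * leb D) = eps by rewrite divfK// gt_eqF//; lra.
by rewrite mulrDr; lra.
Unshelve. all: by end_near. Qed.

Section Riemann.
Variables (w : R -> R) (c d : R) (f : R -> X).
Hypotheses (Hw : modulus_of_continuity w) (cd : c < d).
Hypothesis fw : forall s t, s \in `[c, d] -> t \in `[c, d] ->
  mdist (f s) (f t) <= w `|s - t|.

Definition mesh (m : nat) : R := (d - c) / m.+1%:R.

Definition gridpt (m i : nat) : R := c + i%:R * mesh m.

Definition riemann (m : nat) : X :=
  \big[sladd/slzero]_(i < m.+1) (mesh m *! P (f (gridpt m i))).

Lemma mesh_gt0 m : 0 < mesh m.
Proof. by rewrite divr_gt0// subr_gt0. Qed.

Lemma gridpt_last m : gridpt m m.+1 = d.
Proof. by rewrite /gridpt /mesh mulrC divfK// subrKC. Qed.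

Lemma gridpt_le m i j : (i <= j)%N -> gridpt m i <= gridpt m j.
Proof. by move=> ij; rewrite lerD2l ler_pM2r ?mesh_gt0// ler_nat. Qed.

Lemma gridptS m i : gridpt m i.+1 = gridpt m i + mesh m.
Proof. by rewrite /gridpt -natr1 mulrDl mul1r addrA. Qed.

Lemma gridpt_itv m i : (i <= m.+1)%N -> gridpt m i \in `[c, d].
Proof.
move=> im; have := gridpt_le m im; rewrite gridpt_last in_itv /= => ->; rewrite andbT.
by rewrite lerDl mulr_ge0// ltW ?mesh_gt0.
Qed.

Let cell m t := Num.truncn ((t - c) / mesh m).

Let cell_fiber m i :
  `[c, d]%classic `&` cell m @^-1` [set i] =
  `[c, d]%classic `&` `[gridpt m i, gridpt m i.+1[%classic.
Proof.
apply/seteqP; split => t /=; rewrite !in_itv /= => -[/[dup] /andP[ct td] tcd].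
  move=> ti; split=> //; have := truncn_itv (x := (t - c) / mesh m).
  rewrite -/(cell m t) ti divr_ge0 ?subr_ge0 ?(ltW (mesh_gt0 _))// => /(_ isT).
  by rewrite ler_pdivlMr ?ltr_pdivrMr ?mesh_gt0// -!/(gridpt _ _) lerBrDl ltrBlDl.
move=> ti; split=> //; apply/truncn_def.
by rewrite ler_pdivlMr ?ltr_pdivrMr ?mesh_gt0// -!/(gridpt _ _) lerBrDl ltrBlDl.
Qed.

Let step m t := f (gridpt m (cell m t)).

(** The function [f] may repeat values in different cells, so the partition into cells is used
    through [simple_refine] instead of the fibers of [step m]. *)
Let step_simple m : simple_on `[c, d] (step m) /\
  simple_integral P `[c, d] (step m) = riemann m.
Proof.
have Dfin : (completed_lebesgue_measure `[c, d] < +oo)%E.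
  by rewrite completed_lebesgue_measure_itv ?ltW// ltry.
(* There are [m.+1] cells, but the point [d] falls into an extra one with label [m.+1]. *)
pose E : {fset nat} := [fset i in iota 0 m.+2]%fset.
have memE i : (i \in E) = (i < m.+2)%N.
  rewrite -[RHS](mem_iota 0 m.+2) /E.
  by apply/imfsetP/idP => [[j /= jm ->]//|im]; exists i.
have [|||simp ->] := simple_refine HP Dfin (E := E) (e := cell m)
   (phi := fun i => f (gridpt m i)) (s := step m).
- by move=> i; rewrite cell_fiber; apply: measurableI; exact: lebesgue_set_itv.
- move=> t /=; rewrite in_itv /= => /andP[ct td].
  rewrite memE ltnS -(@ler_nat R).
  have := truncn_le ((t - c) / mesh m).
  rewrite divr_ge0 ?subr_ge0 ?(ltW (mesh_gt0 _))// => /le_trans; apply.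
  by rewrite ler_pdivrMr ?mesh_gt0// lerBlDl -/(gridpt _ _) gridpt_last.
- by [].
split=> //.
rewrite (_ : \big[sladd/slzero]_(i <- E) _ =
   \big[sladd/slzero]_(i <- iota 0 m.+2)
     (leb (`[c, d]%classic `&` cell m @^-1` [set i]) *! P (f (gridpt m i)))); last first.
  apply: perm_big; apply: uniq_perm; rewrite ?fset_uniq ?iota_uniq// => i.
  by rewrite memE mem_iota.
rewrite -[iota _ _]/(index_iota 0 m.+2) big_mkord big_ord_recr /=.
(* The extra cell is the single point [d], of measure zero. *)
rewrite [X in _ +! X](_ : _ = slzero) ?sladdr0; last first.
  rewrite cell_fiber (_ : _ `&` _ = `[d, d]%classic).
    by rewrite /leb completed_lebesgue_measure_itv// subrr slscale0.
  apply/seteqP; split => t /=; rewrite !in_itv /= gridpt_last gridptS gridpt_last.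
    by move=> [/andP[_ ->] /andP[->]].
  by move=> /le_anti <-; have := mesh_gt0 m; rewrite !lexx (ltW cd) ltrDl.
apply: eq_bigr => i _; congr (_ *! _).
rewrite cell_fiber (_ : _ `&` _ = `[gridpt m i, gridpt m i.+1[%classic).
  rewrite /leb completed_lebesgue_measure_itv ?gridpt_le//= gridptS.
  by rewrite addrC addKr.
apply: setIidr => t /=; rewrite !in_itv/= => /andP[it ti].
have := gridpt_itv (ltnW (ltn_ord i)); have := @gridpt_itv m i.+1 (ltn_ord i).
rewrite !in_itv/= => /andP[_ id] /andP[ci _].
by rewrite (le_trans ci it) (le_trans (ltW ti) id).
Qed.

Let mdist_step m t : t \in `[c, d] -> mdist (f t) (step m t) <= w (mesh m).
Proof.
move=> tcd; have : (`[c, d]%classic `&` cell m @^-1` [set cell m t]) t by [].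
rewrite cell_fiber /= !in_itv/= => -[_ /andP[it ti]].
have ccd : gridpt m (cell m t) \in `[c, d].
  move: tcd; rewrite !in_itv/= => /andP[_ td]; rewrite (le_trans it td) andbT.
  by rewrite lerDl mulr_ge0// ltW ?mesh_gt0.
apply: (le_trans (fw tcd ccd)); apply: modulus_le => //.
by rewrite ger0_norm ?subr_ge0// lerBlDl -gridptS ltW.
Qed.

(** The sums are the integrals of [step m], which is within [w (mesh m)] of [f]. They are therefore
    Cauchy, completeness provides a limit, and uniqueness identifies it with the chosen integral. *)
Lemma riemann_cvg_integral : riemann m @[m --> \oo] --> Defs.integral P `[c, d]%classic f.
Proof.
have Dfin : (completed_lebesgue_measure `[c, d] < +oo)%E.
  by rewrite completed_lebesgue_measure_itv ?ltW// ltry.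
have dc0 : 0 < d - c by rewrite subr_gt0.
have small eps : 0 < eps -> \forall m \near \oo, w (mesh m) < eps.
  by move=> e0; apply: modulus_mesh_small => //; exact: ltW.
have : cvg (riemann m @[m --> \oo]).
  apply/cauchy_cvgP/cauchy_exP => eps e0.
  pose del := eps / (4 * (d - c)).
  have d0 : 0 < del by rewrite divr_gt0// mulr_gt0.
  near \oo => m; exists (riemann m).
  have Hm : w (mesh m) < del by near: m; exact: small.
  have := small _ d0; apply: filterS => m' Hm'.
  rewrite ballEmdist /=.
  have [sm <-] := step_simple m; have [sm' <-] := step_simple m'.
  apply: (le_lt_trans (le_mdist_simple_integral HP Dfin sm sm' (eps := 2 * del) _)).
    move=> t Dt; apply: (le_trans (metric_triangle _ (f t) _)).
    rewrite (metric_sym _ (f t)).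
    by rewrite (le_trans (lerD (mdist_step m Dt) (mdist_step m' Dt)))//; lra.
  rewrite /leb completed_lebesgue_measure_itv ?(ltW cd)//=.
  have -> : 2 * del * (d - c) = eps / 2.
    rewrite /del invfM !mulrA divfK ?gt_eqF//; lra.
  lra.
move=> /cvg_ex[l rl].
have Il : is_integral P `[c, d] f l.
  exists step; split => [k||].
  - by have [] := step_simple k.
  - apply/uniform_mdistP => eps /small; apply: filterS => m Hm t tcd.
    exact: le_lt_trans (mdist_step m tcd) Hm.
  - rewrite (_ : (fun k => _) = riemann)//.
    by apply/funext => k; have [] := step_simple k.
rewrite /Defs.integral; case: xgetP => [v _ Iv|/(_ l)//].
by rewrite (is_integral_unique Dfin Iv Il).
Unshelve. all: by end_near. Qed.

(** For convex [z] the left element is itself the Riemann sum of a constant, so the two sums are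
    compared term by term. *)
Lemma le_mdist_riemann z m : convex_elements X z ->
  mdist ((d - c) *! z) (riemann m) <= \sum_(i < m.+1) mesh m * mdist z (P (f (gridpt m i))).
Proof.
move=> cz; have -> : d - c = \sum_(i < m.+1) mesh m.
  by rewrite sumr_const card_ord -mulr_natr /mesh divfK.
rewrite slscale_sumr//; last by move=> _; exact/ltW/mesh_gt0.
rewrite (le_trans (le_mdist_sum _ _ _))//; apply: ler_sum => i _.
by rewrite mdist_slscale gtr0_norm// mesh_gt0.
Qed.

End Riemann.
End Integral.

(** * Real Riemann sums and integrals of the modulus over windows *)

Section RealRiemann.
Variables (R : realType) (w : R -> R).
Hypothesis Hw : modulus_of_continuity w.

Lemma mean_value (f df : R -> R) (a b : R) : a <= b ->
  (forall x, x \in `[a, b] -> is_derive x 1 f (df x)) ->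
  exists2 c, c \in `[a, b] & f b - f a = df c * (b - a).
Proof.
move=> ab fdf.
have fdf' x : x \in `]a, b[ -> is_derive x 1 f (df x).
  by move=> xab; exact: (fdf _ (subset_itv_oo_cc xab)).
suff cf : {within `[a, b], continuous f} by exact: (MVT_segment ab fdf' cf).
apply: derivable_within_continuous => x xab; exact: (@ex_derive _ _ _ _ _ _ _ (fdf _ xab)).
Qed.

(** By the mean value theorem each increment of [G] over a cell is [mesh] times a value of [g] in
    that cell; replacing it by the value at the left end costs at most [w mesh * mesh], in total
    [w mesh * (d - c)]. *)
Lemma riemann_sum_cvg (c d : R) (G g : R -> R) : c < d ->
  (forall x, x \in `[c, d] -> is_derive x 1 G (g x)) ->
  (forall s t, s \in `[c, d] -> t \in `[c, d] -> `|g s - g t| <= w `|s - t|) ->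
  \sum_(i < m.+1) mesh c d m * g (gridpt c d m i) @[m --> \oo] --> G d - G c.
Proof.
move=> cd Gg gw; apply/cvgrPdist_lt => eps e0.
have dc0 : 0 < d - c by rewrite subr_gt0.
have := modulus_mesh_small Hw (ltW dc0) (divr_gt0 e0 dc0).
apply: filterS => m; rewrite -/(mesh c d m) ltr_pdivlMr// => Hm.
apply: le_lt_trans Hm.
have -> : G d - G c = \sum_(i < m.+1) (G (gridpt c d m i.+1) - G (gridpt c d m i)).
  rewrite -(big_mkord xpredT (fun i => G (gridpt c d m i.+1) - G (gridpt c d m i))).
  by rewrite telescope_sumr// gridpt_last /gridpt mul0r addr0.
rewrite -sumrB (le_trans (ler_norm_sum _ _ _))//.
have -> : w (mesh c d m) * (d - c) = \sum_(i < m.+1) w (mesh c d m) * mesh c d m.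
  by rewrite sumr_const card_ord -mulr_natr -mulrA /mesh divfK.
apply: ler_sum => i _.
have iS : gridpt c d m i <= gridpt c d m i.+1 by exact: gridpt_le.
have sub x : x \in `[gridpt c d m i, gridpt c d m i.+1] -> x \in `[c, d].
  have := gridpt_itv cd (ltnW (ltn_ord i)); have := @gridpt_itv _ c d cd m i.+1 (ltn_ord i).
  rewrite !in_itv/= => /andP[_ id] /andP[ci _] /andP[it ti].
  by rewrite (le_trans ci it) (le_trans ti id).
have [xi xiI ->] := mean_value iS (fun x xi => Gg x (sub x xi)).
have m0 := mesh_gt0 cd m.
have -> : gridpt c d m i.+1 - gridpt c d m i = mesh c d m by rewrite gridptS addrAC subrr add0r.
rewrite (mulrC _ (g _)) -mulrBl normrM (gtr0_norm m0) ler_wpM2r ?(ltW m0)//.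
rewrite (le_trans (gw _ _ _ _)) ?sub//.
  by rewrite in_itv/= lexx.
apply: modulus_le => //; move: xiI; rewrite in_itv/= gridptS => /andP[ix xi'].
rewrite ler_norml; lra.
Qed.

Lemma continuous_modulus_norm : continuous (fun x : R => w `|x|).
Proof.
move=> x; apply/cvgrPdist_lt => eps /(modulus_small Hw)[eta eta0 weta].
apply/nbhs_ballP; exists eta => //= y xy.
exact: le_lt_trans (modulus_norm_lipschitz Hw _ _) (weta _ _ xy).
Qed.

(** The integrand is even, so the odd part of any primitive is again a primitive. Oddness handles
    windows on either side of zero at once. *)
Lemma odd_primitive (M : R) : exists F : R -> R,
  (forall x, F (- x) = - F x) /\
  forall x : R, `|x| < M -> is_derive x 1 F (w `|x|).
Proof.
pose F (x : R) : R := \int[lebesgue_measure]_(t in `[- M, x]) w `|t|.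
have F' (x : R) : `|x| < M -> is_derive x 1 F (w `|x|).
  rewrite ltr_norml => /andP[Mx xM].
  have [||dF F'x] := @continuous_FTC1_closed R (fun x => w `|x|) (- M) x M xM _ Mx.
  - apply: continuous_compact_integrable; first exact: segment_compact.
    by apply: continuous_subspaceT; exact: continuous_modulus_norm.
  - exact: continuous_modulus_norm.
  - by rewrite derive1E in F'x; exact: (DeriveDef dF F'x).
exists (fun x => (F x - F (- x)) / 2); split=> [x|x xM].
  by rewrite opprK -mulNr opprB.
have dFN : is_derive x 1 (fun y => F (- y)) (w `|x| * -1).
  apply: (@is_derive1_comp _ F -%R); rewrite -(normrN x).
  by apply: F'; rewrite normrN.
have dF := F' _ xM.
have -> : (fun x => (F x - F (- x)) / 2) = 2^-1 *: (F - (fun y => F (- y))).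
  by apply/funext => y; rewrite mulrC.
apply: is_derive_eq; rewrite /GRing.scale/=; lra.
Qed.

Section Window.
Variables (M h r : R) (F : R -> R).
Hypotheses (FN : forall x, F (- x) = - F x).
Hypotheses (F' : forall x : R, `|x| < M -> is_derive x 1 F (w `|x|)).
Hypotheses (h0 : 0 < h) (hr : h <= r) (rM : r + h < M).

(** For a centre [x >= 0] the increment has derivative [w |x + h| - w |x - h|], nonnegative by
    monotonicity of [w], so it grows up to the centre [r]. *)
Lemma window_le v : `|v| <= r -> F (v + h) - F (v - h) <= F (r + h) - F (r - h).
Proof.
have [h0' hr' rM'] := And3 h0 hr rM.
wlog v0 : v / 0 <= v => [W|].
  have [v0|v0] := leP 0 v; first exact: W.
  (* Oddness of [F] makes the increment an even function of the centre. *)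
  have <- : F (- v + h) - F (- v - h) = F (v + h) - F (v - h).
    have -> : - v + h = - (v - h) by rewrite opprB addrC.
    by rewrite -opprD !FN opprK addrC.
  by move=> vr; apply: W; rewrite ?normrN// oppr_ge0 ltW.
move=> vr; pose phi x := F (x + h) - F (x - h).
have vr' : v <= r by rewrite ger0_norm in vr.
have dphi (x : R) : x \in `[v, r] -> is_derive x 1 phi (w `|x + h| - w `|x - h|).
  move=> xvr.
  have dx (c : R) : `|c| <= h -> is_derive x 1 (fun y : R => F (y + c)) (w `|x + c|).
    move=> ch; rewrite -[w _]mulr1.
    have dF : is_derive (x + c) 1 F (w `|x + c|).
      apply: F'; move: xvr ch; rewrite in_itv/= !ler_norml ltr_norml.
      by move=> /andP[? ?] /andP[? ?]; apply/andP; split; lra.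
    have dc : is_derive x 1 (fun y : R => y + c) 1.
      by rewrite -[X in is_derive _ _ _ X]addr0; exact: is_deriveD.
    exact: (@is_derive1_comp _ F (fun y : R => y + c) _ _ _ dF dc).
  have d1 := dx h; have d2 := dx (- h).
  rewrite normrN gtr0_norm// in d1 d2.
  exact: (is_deriveB (d1 (lexx _)) (d2 (lexx _))).
have [x] := mean_value vr' dphi.
rewrite in_itv/= => /andP[vx xr] E.
rewrite -subr_ge0 -/(phi r) -/(phi v) E mulr_ge0 ?subr_ge0// modulus_le//.
by rewrite ler_norml ger0_norm; lra.
Qed.

Lemma window_integral :
  \int[lebesgue_measure]_(u in `[r - h, r + h]) w u = F (r + h) - F (r - h).
Proof.
have [h0' hr' rM'] := And3 h0 hr rM.
transitivity (\int[lebesgue_measure]_(u in `[r - h, r + h]) w `|u|).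
  apply: eq_Rintegral => u /set_mem; rewrite /= in_itv/= => /andP[ru _].
  by rewrite ger0_norm//; lra.
have dF (x : R) : x \in `[r - h, r + h] -> is_derive x 1 F (w `|x|).
  by rewrite in_itv/= => /andP[? ?]; apply: F'; rewrite ltr_norml; lra.
have cF (x : R) : x \in `[r - h, r + h] -> F y @[y --> x] --> F x.
  move=> /dF[dx _]; exact/differentiable_continuous/derivable1_diffP.
have rh : r - h < r + h by lra.
have [lh rh'] : r - h \in `[r - h, r + h] /\ r + h \in `[r - h, r + h].
  by rewrite !in_itv /= !lexx (ltW rh).
rewrite /Rintegral (@continuous_FTC2 _ _ F)//.
- by apply: continuous_subspaceT; exact: continuous_modulus_norm.
- split=> [x xI||].
  + by have [] := dF x (subset_itv_oo_cc xI).
  + exact/cvg_at_right_filter/cF.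
  + exact/cvg_at_left_filter/cF.
- by move=> x /subset_itv_oo_cc/dF[_ <-]; rewrite derive1E.
Qed.

End Window.

End RealRiemann.

(** * Position of the nodes: a far point and the folding map *)

Section Nodes.
Variables (R : realType).

Lemma far_point (a b : R) (n : nat) (t : 'I_n -> R) : (0 < n)%N -> a < b ->
  exists2 u, u \in `[a, b] & forall k, (b - a) / (2 * n%:R) <= `|u - t k|.
Proof.
move=> n0 ab; set r := (b - a) / (2 * n%:R).
have n0R : 0 < n%:R :> R by rewrite ltr0n.
have r0 : 0 < r by rewrite divr_gt0 ?subr_gt0 ?mulr_gt0.
have r20 : 0 < 2 * r by rewrite mulr_gt0.
(* These [n.+1] points run from [a] to [b] at distance [2 * r] from one another, so a node can be
   closer than [r] to only one of them. *)
pose p (i : 'I_n.+1) : R := a + 2 * r * i%:R.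
have pI i : p i \in `[a, b].
  rewrite in_itv/= /p; apply/andP; split.
    by rewrite lerDl mulr_ge0// ltW.
  rewrite -lerBrDl (le_trans (y := 2 * r * n%:R))//.
    by rewrite ler_pM2l// ler_nat -ltnS.
  by rewrite mulrAC mulrC /r divfK// gt_eqF// mulr_gt0.
apply/not_exists2P => far.
have near_ i : exists k, `|p i - t k| < r.
  have [/(_ (pI i))//|/existsNP[k /negP]] := far (p i).
  by rewrite -ltNge => ?; exists k.
have /choice[f fP] := near_.
have : injective f.
  move=> i j fij; apply/eqP; apply: contraT => ij.
  have := fP i; have := fP j; rewrite fij.
  suff : 2 * r <= `|p i - p j|.
    by move=> ? ? ?; have := ler_distD (t (f j)) (p i) (p j); rewrite (distrC (t _) (p j)); lra.
  have -> : p i - p j = 2 * r * (i%:R - j%:R) by rewrite /p opprD addrACA subrr add0r mulrBr.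
  rewrite normrM gtr0_norm// ler_pMr//.
  rewrite -val_eqE neq_ltn /= in ij; case/orP: ij => ij; first rewrite distrC.
    by rewrite -(natrB _ (ltnW ij)) normr_nat ler1n subn_gt0.
  by rewrite -(natrB _ (ltnW ij)) normr_nat ler1n subn_gt0.
by move/leq_card; rewrite !card_ord ltnn.
Qed.

Section Zigzag.
Variables (a b h : R) (n : nat) (t : 'I_n -> R).
Hypotheses (adm : admissible_nodes a b h n t).

Lemma nodes_gap (i j : 'I_n) : (i <= j)%N -> t i + 2 * h * (j - i)%:R <= t j.
Proof.
case: adm => _ _ tS _.
(* Admissibility relates only consecutive nodes, so [i] moves up to [j] one step at a time. *)
have [k] := ubnP (j - i); elim: k i => // k IH i jik.
rewrite leq_eqVlt => /orP[/eqP/val_inj->|ij].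
  by rewrite subnn mulr0 addr0.
have iSn : (i.+1 < n)%N := leq_ltn_trans ij (ltn_ord j).
have jiSk : (j - Ordinal iSn < k)%N by rewrite /=; lia.
have := IH (Ordinal iSn) jiSk ij; have := tS i (Ordinal iSn) erefl => /=.
by rewrite -[in X in _ -> _ -> X](subnSK ij) -(natr1 (j - _)) mulrDr mulr1; lra.
Qed.

(* Neighbouring windows are folded with opposite orientations [sg], and [kap s]
   is the smaller of [`|s - u|] and of [r - h] plus the distance from [s] to
   those ends of the windows that go to [r - h]. *)
Lemma zigzag (u r : R) : 0 < h -> h <= r -> (forall k, r <= `|u - t k|) ->
  exists (sg : 'I_n -> R) (kap : R -> R),
  [/\ forall k, sg k = 1 \/ sg k = -1,
      forall s s', `|kap s - kap s'| <= `|s - s'|,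
      forall s, 0 <= kap s,
      kap u = 0
    & forall k s, `|s - t k| <= h -> kap s = r + sg k * (s - t k)].
Proof.
move=> h0 hr far.
have tle (i j : 'I_n) : (i <= j)%N -> t i <= t j.
  move=> ij; have := nodes_gap ij; have : 0 <= 2 * h * (j - i)%:R :> R.
    by rewrite !mulr_ge0// ltW.
  lra.
(* The index [p] separates the nodes to the left of [u] from those to its right. *)
have [p [pn plo phi]] : exists p : nat, [/\ (p <= n)%N,
    (forall k : 'I_n, (k < p)%N -> t k <= u - r) &
    (forall k : 'I_n, (p <= k)%N -> u + r <= t k)].
  have exn : [forall k : 'I_n, (n <= k)%N ==> (u <= t k)].
    apply/forallP => k; apply/implyP => nk.
    by have := leq_ltn_trans nk (ltn_ord k); rewrite ltnn.
  have ex : exists p, [forall k : 'I_n, (p <= k)%N ==> (u <= t k)] by exists n.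
  exists (ex_minn ex); case: ex_minnP => p /forallP Hp pmin.
  split=> [|k|k]; first exact: pmin.
    rewrite ltnNge => /negP kp; have := far k; rewrite ler_normr.
    have [ut|tu] := leP u (t k); last by move=> /orP[|]; lra.
    case: kp; apply: pmin; apply/forallP => j; apply/implyP => kj.
    exact: le_trans ut (tle _ _ kj).
  move=> /(implyP (Hp k)) ut; have := far k; rewrite ler_normr.
  by move=> /orP[|]; lra.
(* With this phase [kap] increases away from [u] on the two windows next to [u], those of index [p]
   and [p.-1]. The point [e k] is the end that goes to [r - h]. *)
pose sg (k : 'I_n) : R := (-1) ^+ (k + p).
pose e k : R := t k - sg k * h.
pose kap s := \big[Num.min/`|s - u|]_(k < n) (r - h + `|s - e k|).
have sgE k : sg k = if odd (k + p) then -1 else 1 by rewrite /sg -signr_odd; case: odd.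
have norm_e k s : `|s - t k| <= h -> `|s - e k| = h + sg k * (s - t k).
  rewrite ler_norml /e sgE => /andP[? ?].
  by case: odd; rewrite ?mulN1r ?mul1r; [rewrite ler0_norm|rewrite ger0_norm]; lra.
have kap0 s : 0 <= kap s.
  apply: (big_ind (fun x => 0 <= x)) => // [x y x0 y0|k _].
    by rewrite le_min x0.
  by rewrite addr_ge0// subr_ge0.
exists sg, kap; split=> //.
- by move=> k; rewrite sgE; case: odd; [right|left].
- move=> s s'.
  have lip (c : R) : `| `|s - c| - `|s' - c| | <= `|s - s'|.
    have -> : s - s' = (s - c) - (s' - c) by lra.
    exact: ler_dist_dist.
  apply: (big_ind2 (fun x y => `|x - y| <= `|s - s'|)) => //.
  + move=> x x' y y'; rewrite !ler_norml => /andP[? ?] /andP[? ?].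
    by apply/andP; have [xy|xy] := leP x y; have [xy'|xy'] := leP x' y'; split; lra.
  + move=> k _ /=; have -> (x y : R) : r - h + x - (r - h + y) = x - y by lra.
    exact: lip.
- apply/le_anti/andP; split=> //.
  by rewrite (le_trans (bigmin_le_id _ _ _ _))// subrr normr0.
move=> k s sk.
have Ek : r + sg k * (s - t k) = r - h + `|s - e k| by rewrite norm_e//; lra.
rewrite Ek; apply/le_anti/andP; split; first exact: bigmin_le.
move: (sk); rewrite ler_norml => /andP[sk1 sk2].
apply/bigmin_geP; split=> [|j _].
  rewrite -Ek sgE ler_normr; have [pk|kp] := leqP p k.
    case: ifP => opk; apply/orP; left; last by have := phi k pk; lra.
    (* Here [kap] decreases away from [u]. Parity excludes [k = p], and window [p] in between
       supplies the missing length [2 * h]. *)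
    have pk' : (p < k)%N.
      by rewrite ltn_neqAle pk andbT; apply: contraTneq opk => ->; rewrite addnn odd_double.
    have pn' : (p < n)%N := leq_ltn_trans pk (ltn_ord k).
    have := phi (Ordinal pn') (leqnn _); have := nodes_gap (i := Ordinal pn') pk.
    have : h * 1 <= h * (k - p)%:R by rewrite ler_wpM2l ?(ltW h0)// ler1n subn_gt0.
    by rewrite mulr1 /= -(mulrA 2); lra.
  case: ifP => opk; apply/orP; right; first by have := plo k kp; lra.
  have kp1 : (k < p.-1)%N by lia.
  have pn' : (p.-1 < n)%N by lia.
  have pp' : (p.-1 < p)%N by lia.
  have := plo (Ordinal pn') pp'; have := nodes_gap (j := Ordinal pn') (ltnW kp1).
  have : h * 1 <= h * (p.-1 - k)%:R by rewrite ler_wpM2l ?(ltW h0)// ler1n subn_gt0.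
  by rewrite mulr1 /= -(mulrA 2); lra.
rewrite lerD2l norm_e// /e ler_normr !sgE.
have gap (i i' : 'I_n) m : (i + m <= i')%N -> t i + 2 * (h * m%:R) <= t i'.
  move=> ii'; have := nodes_gap (leq_trans (leq_addr m i) ii').
  have : h * m%:R <= h * (i' - i)%:R.
    by rewrite ler_wpM2l ?(ltW h0)// ler_nat; lia.
  by rewrite -(mulrA 2); lra.
have gap1 (i i' : 'I_n) : (i < i')%N -> t i + 2 * h <= t i'.
  by move=> ii'; have := gap i i' 1%N; rewrite addn1 mulr1; apply.
have gap2 (i i' : 'I_n) : (i.+1 < i')%N -> t i + 4 * h <= t i'.
  by move=> ii'; have := gap i i' 2%N; rewrite addn2 => /(_ ii'); lra.
(* Windows of equal orientation have indices of equal parity, so they are two steps and [4 * h]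
   apart; for opposite orientations [2 * h] suffices. *)
have [kj|jk|/val_inj->] := ltngtP k j.
- apply/orP; right; case: ifP => ok; case: ifP => oj.
  + by have := gap2 k j; rewrite (_ : (k.+1 < j)%N); [lra|lia].
  + by have := gap1 k j kj; lra.
  + by have := gap1 k j kj; lra.
  + by have := gap2 k j; rewrite (_ : (k.+1 < j)%N); [lra|lia].
- apply/orP; left; case: ifP => ok; case: ifP => oj.
  + by have := gap2 j k; rewrite (_ : (j.+1 < k)%N); [lra|lia].
  + by have := gap1 j k jk; lra.
  + by have := gap1 j k jk; lra.
  + by have := gap2 j k; rewrite (_ : (j.+1 < k)%N); [lra|lia].
by case: ifP => _; apply/orP; [right|left]; lra.
Qed.

End Zigzag.
End Nodes.

(** * Distance to a mean value, and the extremal function *)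

Section Bounds.
Variables (R : realType) (X : lspaceType R) (P : X -> X) (w : R -> R).
Hypotheses (HP : convexifying_operator P) (Hw : modulus_of_continuity w).
Implicit Types (a b h r c d : R) (f : R -> X).

Definition window h r : R := \int[lebesgue_measure]_(u in `[r - h, r + h]) w u.

Lemma le_mdist_integral c d f (z : X) (S : nat -> R) (l : R) : c < d ->
  (forall s t, s \in `[c, d] -> t \in `[c, d] -> mdist (f s) (f t) <= w `|s - t|) ->
  (forall m, mdist z (riemann P c d f m) <= S m) -> S @ \oo --> l ->
  mdist z (Defs.integral P `[c, d]%classic f) <= l.
Proof.
move=> cd fw zS Sl; apply/ler_addgt0Pr => /= eps e0.
have := riemann_cvg_integral HP Hw cd fw.
move/metricType_numDomainType.cvgrPdist_lt => /(_ _ (divr_gt0 e0 (ltr0n R 2))) rI.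
move/cvgrPdist_lt : Sl => /(_ _ (divr_gt0 e0 (ltr0n R 2))) Sl.
near \oo => m.
have H1 : mdist (Defs.integral P `[c, d]%classic f) (riemann P c d f m) < eps / 2.
  by near: m.
have H2 : `|l - S m| < eps / 2 by near: m.
apply: (le_trans (metric_triangle _ (riemann P c d f m) _)).
rewrite (metric_sym (riemann _ _ _ _ _)).
have := zS m; move: H2; rewrite ltr_norml => /andP[H2 _]; lra.
Unshelve. all: by end_near. Qed.

Lemma le_mdist_mean a b h r f (t u : R) : 0 < h -> h <= r ->
  Homega X a b w f -> a <= t - h -> t + h <= b -> u \in `[a, b] -> `|u - t| <= r ->
  mdist (P (f u)) ((2 * h)^-1 *! Defs.integral P `[t - h, t + h]%classic f)
    <= (2 * h)^-1 * window h r.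
Proof.
move=> h0 hr Hf ath thb uab utr.
have cd : t - h < t + h by lra.
have h20 : 0 < 2 * h by lra.
have h2n0 : 2 * h != 0 by rewrite gt_eqF.
have sub s : s \in `[t - h, t + h] -> s \in `[a, b].
  by rewrite !in_itv/= => /andP[? ?]; apply/andP; split; lra.
have [F [FN F']] := odd_primitive Hw (r + h + 1).
have rM : r + h < r + h + 1 by lra.
rewrite /window (window_integral Hw F' h0 hr rM).
(* Writing [1] as [(2 * h)^-1 * (2 * h)] turns [P (f u)] into the mean of a constant, so the common
   factor can be taken out. *)
rewrite -[X in mdist X _]slscale1 -[in X in mdist X _](mulVf h2n0).
rewrite -slscaleA mdist_slscale gtr0_norm ?invr_gt0// ler_pM2l ?invr_gt0//.
have fw s s' : s \in `[t - h, t + h] -> s' \in `[t - h, t + h] ->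
  mdist (f s) (f s') <= w `|s - s'| by move=> /sub ? /sub; exact: Hf.
(* These real sums dominate the distances to the Riemann sums; their limit is the increment of [F]
   over the window centred at [t - u], to which [window_le] applies. *)
pose S m := \sum_(i < m.+1) mesh (t - h) (t + h) m * w `|gridpt (t - h) (t + h) m i - u|.
have Sl : S @ \oo --> F (t + h - u) - F (t - h - u).
  have dF (s : R) : s \in `[t - h, t + h] ->
      is_derive s 1 (fun s : R => F (s - u)) (w `|s - u|).
    rewrite in_itv/= => /andP[st ts]; rewrite -[w _]mulr1.
    have dF : is_derive (s - u) 1 F (w `|s - u|).
      apply: F'; move: utr; rewrite ler_norml ltr_norml => /andP[? ?].
      by apply/andP; split; lra.
    have dc : is_derive s 1 (fun y : R => y - u) 1.
      by rewrite -[X in is_derive _ _ _ X]addr0; exact: is_deriveD.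
    exact: (@is_derive1_comp _ F (fun y : R => y - u) _ _ _ dF dc).
  apply: (riemann_sum_cvg Hw cd dF (g := fun s => w `|s - u|)) => s s' _ _.
  rewrite (le_trans (modulus_norm_lipschitz Hw _ _))//.
  by rewrite opprB addrA subrK.
have := window_le Hw FN F' h0 hr rM (v := t - u); rewrite distrC => /(_ utr).
have -> : t - u + h = t + h - u by lra.
have -> : t - u - h = t - h - u by lra.
apply: le_trans.
apply: (le_mdist_integral cd fw _ Sl) => m.
  rewrite {1}(_ : 2 * h = (t + h) - (t - h)); last by lra.
  apply: le_trans.
    by apply: le_mdist_riemann => //; exact: (convexifying_convex HP).
  apply: ler_sum => i _; rewrite ler_wpM2l ?(ltW (mesh_gt0 _ _))//.
  rewrite distrC; case: HP => _ Ple _ _; rewrite (le_trans (Ple _ _))//.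
  by apply: Hf => //; apply: sub; apply: gridpt_itv => //; exact: ltnW.
Qed.

(** A nonzero invertible convex element is divided by its distance from zero; scaling by a positive
    number keeps convexity and the inverse. *)
Lemma invertible_convex_unit :
  invertible_elements X `&` convex_elements X <> [set slzero] ->
  exists x x' : X, [/\ convex_elements X x, convex_elements X x',
    x +! x' = slzero & mdist x slzero = 1].
Proof.
move=> nontriv.
have [x [[x' xx'] cx] x0] : exists2 x,
    (invertible_elements X `&` convex_elements X) x & x <> slzero.
  apply: contra_notP nontriv => /forall2NP H; apply/seteqP; split => x /=.
    by move=> Hx; have [|/contrapT] := H x.
  move=> ->; split; first by exists slzero; rewrite sladdr0.
  by move=> c d _ _; rewrite !slscaler0 sladdr0.
have N0 : 0 < mdist x slzero by rewrite mdist_gt0; exact/eqP.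
pose N := (mdist x slzero)^-1.
have cx' : convex_elements X x' := convexifying_inv HP cx xx'.
have cN y : convex_elements X y -> convex_elements X (N *! y).
  move=> cy c d c0 d0; rewrite !slscaleA mulrDl cy// mulr_ge0// invr_ge0 ltW//.
exists (N *! x), (N *! x'); split; [exact: cN|exact: cN| |].
  by rewrite -slscaleDr xx' slscaler0.
by rewrite -[X in mdist _ X](slscaler0 _ N) mdist_slscale gtr0_norm ?invr_gt0// mulVf// gt_eqF.
Qed.

Lemma is_derive_affine (p q x : R) : is_derive x 1 (fun y : R => p + q * y) q.
Proof.
have := is_deriveD (is_derive_cst p x 1) (is_deriveZ q (is_derive_id x 1)).
by rewrite add0r /GRing.scale/= mulr1.
Qed.

Lemma real_extremal a b h r (n : nat) (t : 'I_n -> R) (u : R) :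
  0 < h -> h <= r -> admissible_nodes a b h n t ->
  (forall k, r <= `|u - t k|) ->
  exists psi : R -> R,
  [/\ forall s s', `|psi s - psi s'| <= w `|s - s'|,
      psi u = (2 * h)^-1 * window h r
    & forall k, \sum_(i < m.+1) mesh (t k - h) (t k + h) m *
        psi (gridpt (t k - h) (t k + h) m i) @[m --> \oo] --> (0 : R)].
Proof.
move=> h0 hr adm far.
have [F [FN F']] := odd_primitive Hw (r + h + 1).
have rM : r + h < r + h + 1 by lra.
have [sg [kap [sg1 kap_lip kap0 kapu kapE]]] := zigzag adm h0 hr far.
set V := _ * _; pose psi s := V - w (kap s).
have h2V : 2 * h * V = F (r + h) - F (r - h).
  rewrite /V mulrA mulfV ?mul1r ?gt_eqF//; last by lra.
  by rewrite /window (window_integral Hw F' h0 hr rM).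
have psi_lip s s' : `|psi s - psi s'| <= w `|s - s'|.
  have -> : psi s - psi s' = w (kap s') - w (kap s) by rewrite /psi; lra.
  rewrite -(ger0_norm (kap0 s)) -(ger0_norm (kap0 s')).
  rewrite (le_trans (modulus_norm_lipschitz Hw _ _))// distrC.
  by apply: modulus_le.
exists psi; split=> //; first by rewrite /psi kapu; case: Hw => _ _ _ _ ->; rewrite subr0.
move=> k; set c := t k - h; set d := t k + h.
have cd : c < d by rewrite /c /d; lra.
have sgsg : sg k * sg k = 1 by case: (sg1 k) => ->; rewrite ?mulr1 ?mulrNN ?mulr1.
pose q := r - sg k * t k.
have kapq s : r + sg k * (s - t k) = q + sg k * s by rewrite /q mulrBr; lra.
(* On the window [kap] is affine with slope [sg k = 1] or [-1], so this is a primitive of [psi]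
   there. The term [0] matches the shape of [is_derive_affine]. *)
pose G s := 0 + V * s - sg k * F (q + sg k * s).
have dG (s : R) : s \in `[c, d] -> is_derive s 1 G (psi s).
  rewrite in_itv/= => /andP[cs sd].
  have stk : `|s - t k| <= h by rewrite ler_norml; move: cs sd; rewrite /c /d => *; lra.
  have sgs : `|sg k * (s - t k)| <= h.
    by rewrite normrM; case: (sg1 k) => ->; rewrite ?normrN normr1 mul1r.
  have dF : is_derive (q + sg k * s) 1 F (w `|q + sg k * s|).
    rewrite -kapq; apply: F'; move: sgs; rewrite ler_norml ltr_norml => /andP[? ?].
    by apply/andP; split; lra.
  have dFc := @is_derive1_comp _ F (fun y : R => q + sg k * y) _ _ _ dF
    (is_derive_affine q (sg k) s).
  have -> : psi s = V - sg k * (w `|q + sg k * s| * sg k).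
    rewrite mulrCA sgsg mulr1 /psi (kapE k)// kapq ger0_norm// -kapq.
    by move: (kap0 s); rewrite (kapE k).
  exact: (is_deriveB (is_derive_affine 0 V s) (is_deriveZ (sg k) dFc)).
have := riemann_sum_cvg Hw cd dG (fun s s' _ _ => psi_lip s s').
(* Both orientations sweep [[r - h, r + h]], and the factor [sg k] compensates the direction; the
   increment of [F] then cancels [2 * h * V]. *)
suff -> : G d - G c = 0 by [].
rewrite /G -!kapq /c /d.
have -> : t k + h - t k = h by lra.
have -> : t k - h - t k = - h by lra.
case: (sg1 k) => ->; rewrite ?mulN1r ?mul1r ?opprK;
  by move: h2V; rewrite -mulrA; nra.
Qed.

End Bounds.

(** * Optimal nodes, lower and upper bounds, and the main result *)

Section Optimality.
Variables (R : realType) (X : lspaceType R) (P : X -> X) (w : R -> R).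
Variables (a b h : R) (n : nat).
Hypotheses (HP : convexifying_operator P) (Hw : modulus_of_continuity w).
Hypotheses (n_gt0 : (0 < n)%N) (h_gt0 : 0 < h).

Let r := (b - a) / (2 * n%:R).

Let nr_gt0 : 0 < n%:R :> R. Proof. by rewrite ltr0n. Qed.

Let nr2_neq0 : 2 * n%:R != 0 :> R. Proof. by rewrite gt_eqF// mulr_gt0. Qed.

Lemma optimal_nodeE k : optimal_node a b n k = a + (2 * k%:R + 1) * r.
Proof. by rewrite /optimal_node -(natr1 k) mulrA /r; congr (_ + _ * _ / _); lra. Qed.

Lemma optimal_length : b = a + 2 * n%:R * r.
Proof. by rewrite /r mulrC divfK// subrKC. Qed.

Lemma cell_endE k : (k <= n)%N -> cell_end a b n k = a + 2 * k%:R * r.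
Proof.
rewrite /cell_end => kn; case: eqVneq => [->|k0]; first by rewrite mulr0 mul0r addr0.
case: eqVneq => [->|_]; first exact: optimal_length.
by rewrite !optimal_nodeE; case: k k0 {kn} => // k _; rewrite /= -(natr1 k); lra.
Qed.

(** The [n] windows of length [2 * h] fit into an interval of length [2 * n * r]. With at least two
    windows, the gap between the first two makes the inequality strict. *)
Lemma admissible_window (t : 'I_n -> R) : admissible_nodes a b h n t ->
  h <= r /\ ((1 < n)%N -> h < r).
Proof.
move=> adm; have [t0 _ tS tn] := adm.
have ln : (n.-1 < n)%N by rewrite prednK.
pose i0 := Ordinal n_gt0; pose il := Ordinal ln.
have H0 := t0 i0 erefl; have Hl : t il + h <= b by apply: tn; rewrite /= prednK.
have nE : n%:R = n.-1%:R + 1 :> R by rewrite natr1 prednK.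
rewrite /r ler_pdivlMr ?ltr_pdivlMr ?mulr_gt0//; split=> [|n1].
  have := nodes_gap adm (leq0n il : (i0 <= il)%N); rewrite subn0 /= nE => H.
  by lra.
pose i1 := Ordinal n1; have H1 := tS i0 i1 erefl.
have il1 : (i1 <= il)%N by rewrite /=; lia.
have := nodes_gap adm il1; rewrite /= => H.
have n1E : n%:R = (n.-1 - 1)%:R + 2 :> R by rewrite -natrD; congr _%:R; lia.
by rewrite n1E; lra.
Qed.

(** Neighbouring nodes are [2 * r] apart and the outer ones are [r] from the end points, so
    strictness is needed only between neighbours. *)
Lemma optimal_nodes_admissible : h <= r -> ((1 < n)%N -> h < r) ->
  admissible_nodes a b h n (optimal_nodes a b n).
Proof.
move=> hr hr1; have h0 := h_gt0; rewrite /optimal_nodes; split=> [i i0|i|i j ji|i iSn].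
- by rewrite optimal_nodeE i0; lra.
- by lra.
- have n1 : (1 < n)%N by have := ltn_ord j; lia.
  by have := hr1 n1; rewrite !optimal_nodeE ji -[i.+1%:R]natr1; lra.
- have nE : i%:R + 1 = n%:R :> R by rewrite natr1 iSn.
  by have := optimal_length; rewrite -nE optimal_nodeE; lra.
Qed.

Lemma cell_close (k : 'I_n) u : u \in `[cell_end a b n k, cell_end a b n k.+1] ->
  `|u - optimal_nodes a b n k| <= r.
Proof.
rewrite in_itv/= /optimal_nodes optimal_nodeE !cell_endE//; last exact: ltnW.
rewrite -[k.+1%:R]natr1 ler_norml => /andP[? ?].
by apply/andP; split; lra.
Qed.

Lemma recovery_error_ge (t : 'I_n -> R) (Phi : ('I_n -> X) -> R -> X) :
  invertible_elements X `&` convex_elements X <> [set slzero] ->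
  admissible_nodes a b h n t ->
  ((optimal_value w a b h n)%:E <= mean_recovery_error P w a b h t Phi)%E.
Proof.
move=> /(invertible_convex_unit HP)[x [x' [cx cx' xx' x1]]] adm.
have [hr _] := admissible_window adm.
have ab : a < b.
  have := mulr_gt0 nr_gt0 (lt_le_trans h_gt0 hr); have := optimal_length; lra.
have [u uab far] := far_point t n_gt0 ab.
have [psi [psi_lip psiu psi0]] := real_extremal Hw h_gt0 hr adm far.
pose f (e : R) (s : R) := line x x' (e * psi s).
have fH e : `|e| = 1 -> Homega X a b w (f e).
  move=> e1 s s' _ _; rewrite /f mdist_line// x1 mulr1 -mulrBr normrM e1 mul1r.
  exact: psi_lip.
have PL c : P (line x x' c) = line x x' c.
  by apply: (convexifying_fix HP); exact: line_convex.
have avg0 e : `|e| = 1 -> averages P h t (f e) = fun=> slzero.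
  move=> e1; apply/funext => k; rewrite /averages.
  suff <- : slzero = Defs.integral P `[t k - h, t k + h]%classic (f e).
    by rewrite slscaler0.
  have cd : t k - h < t k + h by have := h_gt0; lra.
  apply: mdist_positivity; apply/le_anti/andP; split; last exact: mdist_ge0.
  have fw s s' : s \in `[t k - h, t k + h] -> s' \in `[t k - h, t k + h] ->
      mdist (f e s) (f e s') <= w `|s - s'|.
    move=> _ _; rewrite /f mdist_line// x1 mulr1 -mulrBr normrM e1 mul1r.
    exact: psi_lip.
  (* The Riemann sums of [f e] lie on the line, where the distance from zero is the absolute value
     of the real sum of [psi]. *)
  have := cvg_norm (psi0 k); rewrite normr0 => /(_ eventually_filter) Sl.
  apply: (le_mdist_integral HP Hw cd fw _ Sl) => m.
  rewrite /riemann (eq_bigr (fun i : 'I_m.+1 => line x x' (mesh (t k - h) (t k + h) m *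
     (e * psi (gridpt (t k - h) (t k + h) m i))))); last first.
    by move=> i _; rewrite PL -lineZ// ltW// mesh_gt0.
  rewrite line_sum// -(line0 x x') mdist_line// x1 mulr1 sub0r normrN.
  under eq_bigr do rewrite mulrCA.
  by rewrite -mulr_sumr normrM e1 mul1r.
have e1 : `|1| = 1 :> R by rewrite normr1.
have eN1 : `|-1| = 1 :> R by rewrite normrN1.
pose z := Phi (fun=> slzero) u.
have bound e : `|e| = 1 -> ((mdist (P (f e u)) z)%:E <= mean_recovery_error P w a b h t Phi)%E.
  move=> He; apply: (@le_trans _ _ (sup_mdist a b (P \o f e) (Phi (averages P h t (f e))))).
    by apply: ereal_sup_ubound; exists u => //=; rewrite (avg0 _ He).
  by apply: ereal_sup_ubound; exists (f e) => //; exact: fH.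
have : 2 * optimal_value w a b h n <= mdist (P (f 1 u)) z + mdist (P (f (-1) u)) z.
  rewrite (metric_sym (P (f (-1) u))); apply: le_trans (metric_triangle _ z _).
  rewrite !PL mdist_line// x1 mulr1.
  have -> : psi u = optimal_value w a b h n by exact: psiu.
  by apply: le_trans (ler_norm _); lra.
have := bound _ e1; have := bound _ eN1.
(* The two distances add up to at least twice the value, so one of them reaches it. *)
have [H1|H1] := leP (optimal_value w a b h n) (mdist (P (f 1 u)) z).
  by move=> _ H _; apply: le_trans H; rewrite lee_fin.
move=> H _ H2; apply: le_trans H; rewrite lee_fin; lra.
Qed.

Lemma piecewise_error_le (Phi : ('I_n -> X) -> R -> X) : h <= r ->
  admissible_nodes a b h n (optimal_nodes a b n) ->
  piecewise_constant_method P w a b h (n := n) Phi ->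
  (mean_recovery_error P w a b h (optimal_nodes a b n) Phi
    <= (optimal_value w a b h n)%:E)%E.
Proof.
move=> hr adm [_ HPhi]; have r0 : 0 < r := lt_le_trans h_gt0 hr.
apply: ge_ereal_sup => _ [f Hf <-].
apply: ge_ereal_sup => _ [u uab <-]; rewrite lee_fin.
have [k uk ->] := HPhi f Hf u uab.
apply: (le_mdist_mean HP Hw h_gt0 hr Hf) => //; last exact: cell_close.
  rewrite /optimal_nodes optimal_nodeE; have : 0 <= 2 * k%:R * r.
    by apply: mulr_ge0; [rewrite mulr_ge0|exact: ltW].
  by lra.
have := optimal_length; rewrite /optimal_nodes optimal_nodeE.
have : 2 * k.+1%:R * r <= 2 * n%:R * r.
  by rewrite ler_pM2r// ler_pM2l// ler_nat; exact: ltn_ord.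
by rewrite -[k.+1%:R]natr1; lra.
Qed.

(** The cell index is monotone in [u], so its fibers in [[a, b]] are intervals and the method is
    measurable; having finitely many values it is bounded. *)
Lemma piecewise_method_exists : 0 < r ->
  exists Phi, piecewise_constant_method P w a b h (n := n) Phi.
Proof.
move=> r0; have r20 : 0 < 2 * r by rewrite mulr_gt0.
(* Truncation would give index [n] at [u = b]; the minimum puts this point into the last cell. *)
pose cell (u : R) := minn (Num.truncn ((u - a) / (2 * r))) n.-1.
have cell_lt u : (cell u < n)%N by rewrite gtn_min prednK// leqnn orbT.
pose idx u := Ordinal (cell_lt u).
have idx_mono u v : u <= v -> (idx u <= idx v)%N.
  move=> uv; rewrite /= leq_min geq_minr andbT geq_min; apply/orP; left.
  apply: le_truncn; apply: ler_wpM2r; first by rewrite invr_ge0 ltW.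
  by rewrite lerD2r.
exists (fun y u => y (idx u)); split=> [y|f _ u]; last first.
  rewrite in_itv/= => /andP[au ub]; exists (idx u) => //.
  have q0 : 0 <= (u - a) / (2 * r) by rewrite divr_ge0 ?subr_ge0// ltW.
  have := truncn_itv q0; rewrite ler_pdivlMr// ltr_pdivrMr// => /andP[q1 q2].
  rewrite in_itv/= !cell_endE//; last exact: ltnW.
  rewrite /cell; set q := Num.truncn _ in q1 q2 *.
  have [qn|nq] := leqP q n.-1; first by apply/andP; split; lra.
  (* Here [q >= n], which together with [u <= b] forces [u = b]. *)
  have : n%:R * (2 * r) <= q%:R * (2 * r) by rewrite ler_pM2r// ler_nat; lia.
  have : n.-1%:R * (2 * r) <= q%:R * (2 * r) by rewrite ler_pM2r// ler_nat ltnW.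
  have := optimal_length; rewrite prednK// => *.
  by apply/andP; split; lra.
split.
  exists slzero, (\sum_k mdist (y k) slzero) => u _.
  rewrite (bigD1 (idx u))//= lerDl; apply: sumr_ge0 => k _; exact: mdist_ge0.
move=> x _ Y mY; apply: sub_caratheodory.
rewrite (_ : _ `&` _ = \bigcup_(k in [set k : 'I_n | Y (mdist (y k) x)])
    (`[a, b]%classic `&` idx @^-1` [set k])).
  apply: fin_bigcup_measurable => // k _; apply: is_interval_measurable.
  move=> u v [/= uab uk] [/= vab vk] s /andP[us sv]; split=> /=.
    move: uab vab; rewrite !in_itv/= => /andP[au _] /andP[_ vb].
    by rewrite (le_trans au)//= (le_trans sv).
  apply/val_inj/eqP; rewrite eqn_leq -{1}vk -uk.
  by rewrite !idx_mono.
apply/seteqP; split => u /=; first by move=> [uab Yu]; exists (idx u).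
by move=> [k Yk [uab uk]]; rewrite uk.
Qed.

End Optimality.

Theorem theorem3 (R : realType) (X : lspaceType R) (P : X -> X) (w : R -> R)
    (a b h : R) (n : nat) :
  invertible_elements X `&` convex_elements X <> [set slzero] ->
  convexifying_operator P ->
  modulus_of_continuity w ->
  (0 < n)%N -> 0 < h ->
  admissible_nodes a b h n !=set0 ->
  [/\ ereal_inf [set mean_optimal_error P w a b h t
                | t in admissible_nodes a b h n]
        = (optimal_value w a b h n)%:E,
      admissible_nodes a b h n (optimal_nodes a b n),
      mean_optimal_error P w a b h (optimal_nodes a b n)
        = ereal_inf [set mean_optimal_error P w a b h t
                    | t in admissible_nodes a b h n],
      exists Phi, piecewise_constant_method P w a b h (n := n) Phi
    & forall Phi, piecewise_constant_method P w a b h (n := n) Phi ->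
        mean_recovery_error P w a b h (optimal_nodes a b n) Phi
          = (optimal_value w a b h n)%:E].
Proof.
move=> nontriv HP Hw n0 h0 [t adm].
(* The given vector of nodes serves only to bound [h], which is what admissibility of the optimal
   nodes requires. *)
have [hr hr1] := admissible_window n0 h0 adm.
have adm' := optimal_nodes_admissible n0 h0 hr hr1.
have lower t' : admissible_nodes a b h n t' ->
    ((optimal_value w a b h n)%:E <= mean_optimal_error P w a b h t')%E.
  move=> At'; apply: le_ereal_inf_tmp => _ [Phi _ <-].
  exact: recovery_error_ge.
have [Phi HPhi] := piecewise_method_exists P w n0 h0 (lt_le_trans h0 hr).
have opt : mean_optimal_error P w a b h (optimal_nodes a b n) = (optimal_value w a b h n)%:E.
  apply/le_anti/andP; split; last exact: lower.
  apply: (@le_trans _ _ (mean_recovery_error P w a b h (optimal_nodes a b n) Phi)).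
    by apply: ereal_inf_lbound; exists Phi; [case: HPhi|].
  exact: piecewise_error_le.
have inf : ereal_inf [set mean_optimal_error P w a b h t | t in admissible_nodes a b h n]
    = (optimal_value w a b h n)%:E.
  apply/le_anti/andP; split.
    by rewrite -opt; apply: ereal_inf_lbound; exists (optimal_nodes a b n).
  by apply: le_ereal_inf_tmp => _ [t' At' <-]; exact: lower.
split=> //; first by rewrite opt inf.
  by exists Phi.
move=> Psi HPsi; apply/le_anti/andP; split; first exact: piecewise_error_le.
exact: recovery_error_ge.
Qed.
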